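(* Let $F$ be an algebraically closed field of characteristic $0$ and $k\ge2$. Let $h:\mathbb{F}_2^{2k+1}\to\mathbb{F}_2$, $h(a)=\sum_{i=1}^k a_{2i-1}a_{2i}+a_{2k+1}^2$, let $\beta_1(a,b)=h(a+b)-h(a)-h(b)$ be its polarization, let $G=\mathbb{Z}_2^{2k+1}$ (identified with the additive group of $\mathbb{F}_2^{2k+1}$), and let $\beta:G\times G\to F^\times$, $\beta(a,b)=(-1)^{\beta_1(a,b)}$ (so $\mathrm{Rad}(\beta)=\{0,e_{2k+1}\}$). (1) The subset $R^-=\{a\in G\setminus\mathrm{Rad}(\beta)\mid h(a)=1\}$ is a skew root system of Lie type in $(G,\beta)$. (2) The corresponding reduced skew root system of $R^-$ is $\mathbb{Z}_2^{2k}\setminus\{0\}$ in the nonsingular symplectic abelian group $(\mathbb{Z}_2^{2k},\overline\beta)$, where $\overline\beta(a,b)=(-1)^{\sum_{i=1}^k(a_{2i}b_{2i-1}-a_{2i-1}b_{2i})}$. Moreover $R^-$ is nonreduced and indecomposable, $|R^-|=2^{2k}-1$, and $L(R^-)\cong\mathfrak{sl}(2^k,F)$.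
   Context: An alternating bicharacter on an abelian group $G$ is a $\mathbb{Z}$-bilinear map $\beta:G\times G\to F^\times$ with $\beta(g,g)=1$ for all $g$; then $(G,\beta)$ is a symplectic abelian group, $\mathrm{Rad}(\beta)=\{g\in G:\beta(g,h)=1\ \forall h\in G\}$, and $(G,\beta)$ is nonsingular if $\mathrm{Rad}(\beta)=0$. Subsets $A,B\subseteq G$ are orthogonal if $\beta(a,b)=1$ for all $a\in A,b\in B$. $R\subseteq G$ is a skew root system of Lie type in $(G,\beta)$ if $\mathrm{Rad}(\beta)\ne G$ and: $R\subseteq G\setminus\mathrm{Rad}(\beta)$ generates $G$; $R=-R$; and $a,b\in R$, $\beta(a,b)\ne1$ imply $a+b\in R$. It is reduced if $\mathrm{Rad}(\beta)=0$. It is decomposable if $G$ is the orthogonal direct sum of two proper subgroups $G_1,G_2$, $R$ is the union of two orthogonal subsets $R_1,R_2$, and $R_i$ is a skew root system of Lie type in $(G_i,\beta|_{G_i\times G_i})$ for $i=1,2$; otherwise indecomposable. The corresponding reduced skew root system of $(G,\beta,R)$ is $(\overline G,\overline\beta,\overline R)$, where $\overline G=G/\mathrm{Rad}(\beta)$, $\overline\beta$ is the bicharacter on $\overline G$ induced by $\beta$, and $\overline R$ is the image of $R$; here $\overline G$ is identified with $\mathbb{Z}_2^{2k}$ via $(a_1,\dots,a_{2k+1})\mapsto(a_1,\dots,a_{2k})$. Choose a 2-cocycle $\xi\in Z^2(G,F^\times)$ with $\xi(a,b)\xi(b,a)^{-1}=\beta(a,b)$ (it exists; different choices give isomorphic graded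 algebras), and let $F^\xi G$ be the associative algebra with basis $\{u_g:g\in G\}$ and $u_au_b=\xi(a,b)u_{a+b}$. Then $L(R)=\bigoplus_{a\in R}Fu_a$ with $[x,y]=xy-yx$. *)

(* Defs.v *)
From HB Require Import structures.
From mathcomp Require Import all_boot all_algebra.
From mathcomp Require Import all_classical.
From mathcomp Require Import ring.

Set Implicit Arguments.
Unset Strict Implicit.
Unset Printing Implicit Defensive.

Import GRing.Theory.

Local Open Scope classical_set_scope.
Local Open Scope quotient_scope.
Local Open Scope ring_scope.

Section SymplecticGroups.
Variables (F : fieldType) (G : zmodType).

Record alt_bichar := AltBichar {
  bichar :> G -> G -> F;
  bichar_neq0 : forall a b, bichar a b != 0;
  bicharDl : forall a b c, bichar (a + b) c = bichar a c * bichar b c;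
  bicharDr : forall a b c, bichar a (b + c) = bichar a b * bichar a c;
  bichar_alt : forall a, bichar a a = 1
}.

Definition is_subgroup (H : set G) : Prop :=
  H 0 /\ forall a b, H a -> H b -> H (a - b).

Variable beta : alt_bichar.

Definition orthogonal_sets (A B : set G) : Prop :=
  forall a b, A a -> B b -> beta a b = 1.

(* The radical of the restriction of beta to H x H. *)
Definition rad_in (H : set G) : set G :=
  [set g | H g /\ forall h, H h -> beta g h = 1].

Definition bichar_rad : set G := rad_in setT.

Definition nonsingular : Prop := bichar_rad = [set 0].

(* R is a skew root system of Lie type in (H, beta restricted to H x H). *)
Definition skew_root_system_in (H R : set G) : Prop :=
  [/\ rad_in H <> H,
      R `<=` H `\` rad_in H,
      forall K : set G, is_subgroup K -> R `<=` K -> H `<=` K,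
      R = [set - a | a in R] &
      forall a b, R a -> R b -> beta a b <> 1 -> R (a + b)].

Definition skew_root_system (R : set G) : Prop := skew_root_system_in setT R.

(* Meant for a skew root system R: reducedness only depends on beta. *)
Definition reduced (R : set G) : Prop := nonsingular.

Definition orthogonal_direct_sum (G1 G2 : set G) : Prop :=
  [/\ [set a + b | a in G1 & b in G2] = setT,
      G1 `&` G2 = [set 0] &
      orthogonal_sets G1 G2].

Definition decomposable (R : set G) : Prop :=
  exists G1 G2 R1 R2 : set G,
    [/\ is_subgroup G1 /\ G1 <> setT, is_subgroup G2 /\ G2 <> setT,
        orthogonal_direct_sum G1 G2,
        R = R1 `|` R2 /\ orthogonal_sets R1 R2 &
        skew_root_system_in G1 R1 /\ skew_root_system_in G2 R2].

Definition indecomposable (R : set G) : Prop := ~ decomposable R.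

End SymplecticGroups.

Section Reduction.
Variables (F : fieldType) (G : zmodType) (beta : alt_bichar F G).

Definition rad_pred : {pred G} := [pred g | g \in bichar_rad beta].

Lemma bichar0l a : beta 0 a = 1.
Proof.
apply: (mulfI (bichar_neq0 beta 0 a)).
by rewrite -bicharDl addr0 mulr1.
Qed.

Lemma bicharC a b : beta a b * beta b a = 1.
Proof.
have := bichar_alt beta (a + b).
by rewrite bicharDl !bicharDr !bichar_alt mul1r mulr1.
Qed.

Lemma rad_predP g : (g \in rad_pred) <-> (forall h, beta g h = 1).
Proof.
split=> [gR h|gR]; last first.
  by have : g \in bichar_rad beta by apply/mem_set.
have /set_mem [_] : g \in bichar_rad beta by [].
exact.
Qed.

Fact rad_zmod_closed : zmod_closed rad_pred.
Proof.
split; first by apply/rad_predP => h; apply: bichar0l.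
move=> a b /rad_predP ra /rad_predP rb; apply/rad_predP => h.
apply: (mulIf (bichar_neq0 beta b h)).
by rewrite -bicharDl subrK ra rb mulr1.
Qed.

HB.instance Definition _ := GRing.isZmodClosed.Build G rad_pred rad_zmod_closed.

Definition quot_rad := Quotient.quot rad_pred.

HB.instance Definition _ := GRing.Zmodule.on quot_rad.

Definition quot_proj (a : G) : quot_rad := \pi_(Quotient.quot rad_pred) a.

Definition quot_bichar_fun (x y : quot_rad) : F :=
  beta (repr (x : Quotient.quot rad_pred)) (repr (y : Quotient.quot rad_pred)).

Lemma quot_bicharE a b :
  quot_bichar_fun (quot_proj a) (quot_proj b) = beta a b.
Proof.
have rE c : exists2 r, r \in rad_pred & repr (\pi_(Quotient.quot rad_pred) c) = r + c.
  exists (repr (\pi_(Quotient.quot rad_pred) c) - c); last by rewrite subrK.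
  by rewrite Quotient.idealrBE reprK.
rewrite /quot_bichar_fun /quot_proj.
have [r /rad_predP rr ->] := rE a; have [s /rad_predP rs ->] := rE b.
rewrite bicharDl rr mul1r bicharDr.
by have := bicharC a s; rewrite rs mulr1 => ->; rewrite mul1r.
Qed.

Lemma quot_projD a b : quot_proj (a + b) = quot_proj a + quot_proj b.
Proof. by rewrite /quot_proj piE. Qed.

Lemma quot_projP (x : quot_rad) : exists a, x = quot_proj a.
Proof. by exists (repr (x : Quotient.quot rad_pred)); rewrite /quot_proj reprK. Qed.

Fact quot_bichar_neq0 x y : quot_bichar_fun x y != 0.
Proof. exact: bichar_neq0. Qed.

Fact quot_bicharDl x y z :
  quot_bichar_fun (x + y) z = quot_bichar_fun x z * quot_bichar_fun y z.
Proof.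
have [[[a ->] [b ->]] [c ->]] := (quot_projP x, quot_projP y, quot_projP z).
by rewrite -quot_projD !quot_bicharE bicharDl.
Qed.

Fact quot_bicharDr x y z :
  quot_bichar_fun x (y + z) = quot_bichar_fun x y * quot_bichar_fun x z.
Proof.
have [[[a ->] [b ->]] [c ->]] := (quot_projP x, quot_projP y, quot_projP z).
by rewrite -quot_projD !quot_bicharE bicharDr.
Qed.

Fact quot_bichar_alt x : quot_bichar_fun x x = 1.
Proof. exact: bichar_alt. Qed.

(* By quot_bicharE, this does not depend on the representatives used. *)
Definition quot_bichar : alt_bichar F quot_rad :=
  AltBichar quot_bichar_neq0 quot_bicharDl quot_bicharDr quot_bichar_alt.

Definition quot_roots (R : set G) : set quot_rad := quot_proj @` R.

End Reduction.

Arguments quot_roots {F G} beta R.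

Section TwistedGroupAlgebra.
Variables (F : fieldType) (G : finZmodType).

Record cocycle2 := Cocycle2 {
  cocycle :> G -> G -> F;
  cocycle_neq0 : forall a b, cocycle a b != 0;
  cocycleP : forall a b c,
    cocycle a b * cocycle (a + b) c = cocycle b c * cocycle a (b + c)
}.

Definition cocycle_for (xi : cocycle2) (beta : alt_bichar F G) : Prop :=
  forall a b, xi a b * (xi b a)^-1 = beta a b.

(* A function x stands for the sum over g of x g *: u_g. *)
Definition tw_alg (xi : cocycle2) : Type := {ffun G -> F^o}.

HB.instance Definition _ xi := GRing.Lmodule.copy (tw_alg xi) {ffun G -> F^o}.

Variable xi : cocycle2.

Definition tw_basis (g : G) : tw_alg xi := [ffun a => (a == g)%:R].

Definition tw_mul (x y : tw_alg xi) : tw_alg xi :=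
  \sum_a \sum_b (x a * y b * xi a b) *: tw_basis (a + b).

Definition tw_one : tw_alg xi := (xi 0 0)^-1 *: tw_basis 0.

Lemma tw_expand (x : tw_alg xi) : x = \sum_a x a *: tw_basis a.
Proof.
apply/ffunP => c; rewrite sum_ffunE (bigD1 c) //= big1 ?addr0.
  by rewrite !ffunE eqxx /GRing.scale /= mulr1.
by move=> a /negPf ac; rewrite !ffunE eq_sym ac scaler0.
Qed.

Fact tw_mulDl : left_distributive tw_mul +%R.
Proof.
move=> x y z; rewrite /tw_mul -big_split; apply: eq_bigr => a _.
rewrite -big_split; apply: eq_bigr => b _ /=.
by rewrite -scalerDl ffunE !mulrDl.
Qed.

Fact tw_mulDr : right_distributive tw_mul +%R.
Proof.
move=> x y z; rewrite /tw_mul -big_split; apply: eq_bigr => a _.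
rewrite -big_split; apply: eq_bigr => b _ /=.
by rewrite -scalerDl ffunE mulrDr mulrDl.
Qed.

Fact tw_scalerAl (k : F) (x y : tw_alg xi) :
  k *: tw_mul x y = tw_mul (k *: x) y.
Proof.
rewrite /tw_mul scaler_sumr; apply: eq_bigr => a _.
rewrite scaler_sumr; apply: eq_bigr => b _.
by rewrite scalerA ffunE /GRing.scale /= !mulrA.
Qed.

Fact tw_scalerAr (k : F) (x y : tw_alg xi) :
  k *: tw_mul x y = tw_mul x (k *: y).
Proof.
rewrite /tw_mul scaler_sumr; apply: eq_bigr => a _.
rewrite scaler_sumr; apply: eq_bigr => b _.
by rewrite scalerA ffunE /GRing.scale /= !mulrA (mulrC k).
Qed.

Lemma tw_mul_basis a b :
  tw_mul (tw_basis a) (tw_basis b) = xi a b *: tw_basis (a + b).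
Proof.
rewrite /tw_mul (bigD1 a) //= [X in _ + X]big1 ?addr0; last first.
  move=> c /negPf ca; apply: big1 => d _.
  by rewrite ffunE ca !mul0r scale0r.
rewrite (bigD1 b) //= big1 ?addr0; last first.
  by move=> d /negPf db; rewrite !ffunE db mulr0 mul0r scale0r.
by rewrite !ffunE !eqxx !mul1r.
Qed.

Lemma tw_mul_suml I (r : seq I) (X : I -> tw_alg xi) y :
  tw_mul (\sum_(i <- r) X i) y = \sum_(i <- r) tw_mul (X i) y.
Proof.
apply: (big_morph (tw_mul^~ y)) => [u v|]; first exact: tw_mulDl.
by apply: big1 => a _; apply: big1 => b _; rewrite ffunE !mul0r scale0r.
Qed.

Lemma tw_mul_sumr I (r : seq I) (X : I -> tw_alg xi) y :
  tw_mul y (\sum_(i <- r) X i) = \sum_(i <- r) tw_mul y (X i).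
Proof.
apply: (big_morph (tw_mul y)) => [u v|]; first exact: tw_mulDr.
by apply: big1 => a _; apply: big1 => b _; rewrite ffunE mulr0 mul0r scale0r.
Qed.

Lemma tw_mul_expandl x y : tw_mul x y = \sum_a x a *: tw_mul (tw_basis a) y.
Proof.
rewrite {1}(tw_expand x) tw_mul_suml.
by apply: eq_bigr => a _; rewrite -tw_scalerAl.
Qed.

Lemma tw_mul_expandr x y : tw_mul x y = \sum_a y a *: tw_mul x (tw_basis a).
Proof.
rewrite {1}(tw_expand y) tw_mul_sumr.
by apply: eq_bigr => a _; rewrite -tw_scalerAr.
Qed.

Fact tw_mulA : associative tw_mul.
Proof.
move=> x y z; rewrite [LHS]tw_mul_expandl (tw_mul_expandl x y) [RHS]tw_mul_suml.
apply: eq_bigr => a _; rewrite -tw_scalerAl; congr (_ *: _).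
rewrite (tw_mul_expandl y z) (tw_mul_expandr _ y) [LHS]tw_mul_sumr.
rewrite [RHS]tw_mul_suml; apply: eq_bigr => b _.
rewrite -tw_scalerAl -tw_scalerAr; congr (_ *: _).
rewrite (tw_mul_expandr _ z) [LHS]tw_mul_sumr [RHS]tw_mul_expandr.
apply: eq_bigr => c _; rewrite -tw_scalerAr; congr (_ *: _).
rewrite !tw_mul_basis -tw_scalerAl -tw_scalerAr !tw_mul_basis !scalerA addrA.
by rewrite -cocycleP.
Qed.

Lemma cocycle0l a : xi 0 a = xi 0 0.
Proof.
apply: (mulfI (cocycle_neq0 xi 0 a)).
by rewrite [RHS]mulrC; have := cocycleP xi 0 0 a; rewrite !add0r => ->.
Qed.

Lemma cocycle0r a : xi a 0 = xi 0 0.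
Proof.
apply: (mulIf (cocycle_neq0 xi a 0)).
by have := cocycleP xi a 0 0; rewrite !addr0.
Qed.

Fact tw_mul1 : left_id tw_one tw_mul.
Proof.
move=> x; rewrite [RHS]tw_expand {1}(tw_expand x) tw_mul_sumr.
apply: eq_bigr => a _; rewrite -tw_scalerAl -tw_scalerAr tw_mul_basis add0r.
by rewrite cocycle0l !scalerA mulrAC mulVf ?mul1r ?cocycle_neq0.
Qed.

Fact tw_mulr1 : right_id tw_one tw_mul.
Proof.
move=> x; rewrite [RHS]tw_expand {1}(tw_expand x) tw_mul_suml.
apply: eq_bigr => a _; rewrite -tw_scalerAl -tw_scalerAr tw_mul_basis addr0.
by rewrite cocycle0r !scalerA -mulrA mulVf ?mulr1 ?cocycle_neq0.
Qed.

Fact tw_one_neq0 : tw_one != 0.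
Proof.
apply/eqP => /ffunP/(_ 0); rewrite !ffunE eqxx /GRing.scale /= mulr1.
by apply/eqP; rewrite invr_eq0 cocycle_neq0.
Qed.

HB.instance Definition _ := GRing.Zmodule_isNzRing.Build (tw_alg xi)
  tw_mulA tw_mul1 tw_mulr1 tw_mulDl tw_mulDr tw_one_neq0.
HB.instance Definition _ :=
  GRing.Lmodule_isLalgebra.Build F (tw_alg xi) tw_scalerAl.
HB.instance Definition _ :=
  GRing.Lalgebra_isAlgebra.Build F (tw_alg xi) tw_scalerAr.

Definition root_space (R : set G) : set (tw_alg xi) :=
  [set x | exists c : G -> F, x = \sum_(a in R) c a *: tw_basis a].

End TwistedGroupAlgebra.

Arguments root_space {F G} xi R.

Definition ring_commutator (A : pzRingType) (x y : A) : A := x * y - y * x.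

Definition lie_subalgebra (F : fieldType) (A : lmodType F) (br : A -> A -> A)
    (U : set A) : Prop :=
  [/\ U 0,
      forall (c : F) x y, U x -> U y -> U (c *: x + y) &
      forall x y, U x -> U y -> U (br x y)].

(* An isomorphism U -> V is given by a function on the ambient space whose
   values outside U are irrelevant. *)
Definition lie_isomorphic (F : fieldType) (A B : lmodType F)
    (brA : A -> A -> A) (brB : B -> B -> B) (U : set A) (V : set B) : Prop :=
  [/\ lie_subalgebra brA U, lie_subalgebra brB V &
      exists f : A -> B,
        [/\ set_bij U V f,
            forall (c : F) x y, U x -> U y -> f (c *: x + y) = c *: f x + f y &
            forall x y, U x -> U y -> f (brA x y) = brB (f x) (f y)]].

Definition sl (n : nat) (F : fieldType) : set 'M[F]_n :=
  [set M | \tr M = 0].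
Arguments sl : clear implicits.

Section SignBichar.
Variable F : fieldType.

Definition sgn2 (x : 'F_2) : F := (-1) ^+ (x : nat).

Lemma sgn2D x y : sgn2 (x + y) = sgn2 x * sgn2 y.
Proof.
rewrite /sgn2 -exprD.
by case: x y => [[|[|[]]] // ?] [[|[|[]]] // ?] /=; rewrite ?expr2 ?mulrNN ?mulr1.
Qed.

Lemma sgn2_neq0 x : sgn2 x != 0.
Proof. by rewrite /sgn2 expf_neq0 // oppr_eq0 oner_eq0. Qed.

End SignBichar.

Section QuadraticForm.
Variable k : nat.

(* Positions are 0-based: fst_idx i, snd_idx i (i < k) and last_idx stand for
   the 1-based coordinates 2j-1, 2j (j = i+1) and 2k+1. *)
Fact fst_idx_subproof (i : 'I_k) : (i.*2 < 2 * k)%N.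
Proof. by rewrite mul2n ltn_double. Qed.

Fact snd_idx_subproof (i : 'I_k) : (i.*2.+1 < 2 * k)%N.
Proof. by rewrite mul2n ltn_Sdouble. Qed.

Definition fst_idx (i : 'I_k) : 'I_(2 * k) := Ordinal (fst_idx_subproof i).
Definition snd_idx (i : 'I_k) : 'I_(2 * k) := Ordinal (snd_idx_subproof i).

Definition last_idx : 'I_(2 * k + 1) := rshift (2 * k) ord0.

Definition hform (a : 'rV['F_2]_(2 * k + 1)) : 'F_2 :=
  \sum_(i < k) a 0 (lshift 1 (fst_idx i)) * a 0 (lshift 1 (snd_idx i))
  + a 0 last_idx ^+ 2.

Definition polarization (a b : 'rV['F_2]_(2 * k + 1)) : 'F_2 :=
  hform (a + b) - hform a - hform b.

Definition bar_form (a b : 'rV['F_2]_(2 * k)) : 'F_2 :=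
  \sum_(i < k) (a 0 (snd_idx i) * b 0 (fst_idx i)
                - a 0 (fst_idx i) * b 0 (snd_idx i)).

Definition e_last : 'rV['F_2]_(2 * k + 1) := delta_mx 0 last_idx.

Lemma addrr_F2 (x : 'F_2) : x + x = 0.
Proof. by case: x => [[|[|[]]] // ?]; apply: val_inj. Qed.

Lemma oppr_F2 (x : 'F_2) : - x = x.
Proof. by apply/eqP; rewrite eq_sym -addr_eq0 addrr_F2. Qed.

Lemma bar_formDl a b c : bar_form (a + b) c = bar_form a c + bar_form b c.
Proof.
rewrite /bar_form -big_split; apply: eq_bigr => i _ /=.
by rewrite !mxE; ring.
Qed.

Lemma bar_formDr a b c : bar_form a (b + c) = bar_form a b + bar_form a c.
Proof.
rewrite /bar_form -big_split; apply: eq_bigr => i _ /=.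
by rewrite !mxE; ring.
Qed.

Lemma bar_form_alt a : bar_form a a = 0.
Proof. by apply: big1 => i _; rewrite mulrC subrr. Qed.

Lemma polarizationE a b : polarization a b = bar_form (lsubmx a) (lsubmx b).
Proof.
rewrite /polarization /hform /bar_form.
have -> : (a + b) 0 last_idx ^+ 2 = a 0 last_idx ^+ 2 + b 0 last_idx ^+ 2.
  by rewrite mxE sqrrD mulr2n addrr_F2 addr0.
set x := _ ^+ 2; set y := b 0 _ ^+ 2.
set p := \sum_i _; set q := \sum_i _; set r := \sum_i _; set s := \sum_i _.
have -> : p = q + r + s.
  rewrite /p /q /r /s -!big_split; apply: eq_bigr => i _ /=.
  by rewrite !mxE oppr_F2; ring.
by ring.
Qed.

End QuadraticForm.

Section Bicharacters.
Variables (F : fieldType) (k : nat).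

Definition beta_fun (a b : 'rV['F_2]_(2 * k + 1)) : F :=
  sgn2 F (polarization a b).

Fact beta_neq0 a b : beta_fun a b != 0.
Proof. exact: sgn2_neq0. Qed.

Fact betaDl a b c : beta_fun (a + b) c = beta_fun a c * beta_fun b c.
Proof. by rewrite /beta_fun !polarizationE linearD bar_formDl sgn2D. Qed.

Fact betaDr a b c : beta_fun a (b + c) = beta_fun a b * beta_fun a c.
Proof. by rewrite /beta_fun !polarizationE linearD bar_formDr sgn2D. Qed.

Fact beta_alt a : beta_fun a a = 1.
Proof. by rewrite /beta_fun polarizationE bar_form_alt. Qed.

Definition beta : alt_bichar F 'rV['F_2]_(2 * k + 1) :=
  AltBichar beta_neq0 betaDl betaDr beta_alt.

Definition beta_bar_fun (a b : 'rV['F_2]_(2 * k)) : F := sgn2 F (bar_form a b).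

Fact beta_bar_neq0 a b : beta_bar_fun a b != 0.
Proof. exact: sgn2_neq0. Qed.

Fact beta_barDl a b c :
  beta_bar_fun (a + b) c = beta_bar_fun a c * beta_bar_fun b c.
Proof. by rewrite /beta_bar_fun bar_formDl sgn2D. Qed.

Fact beta_barDr a b c :
  beta_bar_fun a (b + c) = beta_bar_fun a b * beta_bar_fun a c.
Proof. by rewrite /beta_bar_fun bar_formDr sgn2D. Qed.

Fact beta_bar_alt a : beta_bar_fun a a = 1.
Proof. by rewrite /beta_bar_fun bar_form_alt. Qed.

Definition beta_bar : alt_bichar F 'rV['F_2]_(2 * k) :=
  AltBichar beta_bar_neq0 beta_barDl beta_barDr beta_bar_alt.

(* A cocycle inducing beta exists. *)
Definition half_form (a b : 'rV['F_2]_(2 * k + 1)) : 'F_2 :=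
  \sum_(i < k) a 0 (lshift 1 (fst_idx i)) * b 0 (lshift 1 (snd_idx i)).

Lemma half_formDl a b c : half_form (a + b) c = half_form a c + half_form b c.
Proof.
rewrite /half_form -big_split; apply: eq_bigr => i _ /=.
by rewrite !mxE mulrDl.
Qed.

Lemma half_formDr a b c : half_form a (b + c) = half_form a b + half_form a c.
Proof.
rewrite /half_form -big_split; apply: eq_bigr => i _ /=.
by rewrite !mxE mulrDr.
Qed.

Fact half_cocycleP a b c :
  sgn2 F (half_form a b) * sgn2 F (half_form (a + b) c) =
  sgn2 F (half_form b c) * sgn2 F (half_form a (b + c)).
Proof. by rewrite -!sgn2D half_formDl half_formDr; congr sgn2; ring. Qed.

Definition half_cocycle : cocycle2 F 'rV['F_2]_(2 * k + 1) :=
  Cocycle2 (fun a b => sgn2_neq0 F (half_form a b)) half_cocycleP.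

Lemma cocycle_for_beta : cocycle_for half_cocycle beta.
Proof.
move=> a b; apply: (mulIf (sgn2_neq0 F (half_form b a))).
rewrite /= divfK ?sgn2_neq0 // /beta_fun -sgn2D polarizationE; congr sgn2.
rewrite /half_form /bar_form -big_split; apply: eq_bigr => i _ /=.
rewrite !mxE oppr_F2.
by rewrite [X in _ + X]mulrC addrAC addrr_F2 add0r.
Qed.

Definition Rminus : set 'rV['F_2]_(2 * k + 1) :=
  [set a | ~ bichar_rad beta a /\ hform a = 1].

End Bicharacters.

Arguments Rminus : clear implicits.

(* Main.v *)
Require Import Defs.
From HB Require Import structures.
From mathcomp Require Import all_boot all_algebra.
From mathcomp Require Import all_classical.
From mathcomp Require Import ring.

(** Write a vector of F_2^(2k+1) as (v, t) with v in F_2^(2k).  Then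
    h (v, t) = quad v + t, and beta is the pullback of the nondegenerate
    symplectic form bar_form along (v, t) |-> v, so its radical is the line
    v = 0.  The condition h = 1 determines t from v; hence the roots are the
    lifts (v, 1 + quad v) of the nonzero v ([RminusE]).  This gives the
    cardinality and the reduction.  The root system is closed because h adds up
    to 1 + 1 + 1 = 1 on a sum of two non-orthogonal roots, and it generates the
    group because the lift fails to be additive on orthogonal vectors
    ([Rminus_generates]).  It is indecomposable since any two roots have a
    common non-orthogonal root ([bar_form_common],
    [indecomposable_of_common_neighbour]).

    For the Lie algebra, the Pauli matrices of size 2^k, indexed by F_2^(2k),
    multiply according to the explicit cocycle half_form, which also has
    commutator beta.  An arbitrary cocycle xi with this commutator differs from
    that one by a symmetric cocycle, which is a coboundary over an algebraically
    closed field ([symmetric_cocycle_coboundary]); so suitably rescaled Pauli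
    matrices represent the twisted group algebra of xi ([pauli_rep]).  The Pauli
    matrices form a basis of the matrix algebra in which all but the identity
    are traceless ([pauli_free], [pauli_span], [trace_pauli]).  Since the roots
    biject with the nonzero v, the representation restricts to a linear
    bijection from the root space onto sl. *)

Set Implicit Arguments.
Unset Strict Implicit.
Unset Printing Implicit Defensive.

Import GRing.Theory.

Local Open Scope classical_set_scope.
Local Open Scope quotient_scope.
Local Open Scope ring_scope.

(** * The field with two elements and its sign character *)

Lemma F2_eq01 (x : 'F_2) : x = 0 \/ x = 1.
Proof. by case: x => [[|[|[]]] // ?]; [left | right]; apply: val_inj. Qed.

Lemma F2_neq0 (x : 'F_2) : x != 0 -> x = 1.
Proof. by case: (F2_eq01 x) => -> //; rewrite eqxx. Qed.

Lemma oppr_rVF2 n (a : 'rV['F_2]_n) : - a = a.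
Proof. by apply/rowP => i; rewrite !mxE oppr_F2. Qed.

Lemma addrr_rVF2 n (a : 'rV['F_2]_n) : a + a = 0.
Proof. by rewrite -{2}(oppr_rVF2 a) subrr. Qed.

Lemma sgn2_1 (F : fieldType) : sgn2 F 1 = -1.
Proof. by []. Qed.

Lemma sgn2_sq (F : fieldType) x : sgn2 F x * sgn2 F x = 1.
Proof. by rewrite -sgn2D addrr_F2. Qed.

Lemma neqN1 (F : fieldType) : (2%:R : F) != 0 -> (-1 : F) != 1.
Proof. by move=> two; rewrite eq_sym -addr_eq0. Qed.

Lemma sgn2_eq1 (F : fieldType) (two : (2%:R : F) != 0) x :
  sgn2 F x = 1 <-> x = 0.
Proof.
case: (F2_eq01 x) => -> //; rewrite sgn2_1.
by split=> [/eqP|//]; rewrite (negPf (neqN1 two)).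
Qed.

Lemma sgn2_neq1 (F : fieldType) (two : (2%:R : F) != 0) x :
  sgn2 F x <> 1 <-> x = 1.
Proof.
rewrite sgn2_eq1 //; split=> [/eqP/F2_neq0 //|->].
by apply/eqP; rewrite oner_eq0.
Qed.

(** * The symplectic form on F_2^(2k) and the quadratic form h *)

Section SymplecticForm.
Variable k : nat.
Implicit Types (v w : 'rV['F_2]_(2 * k)) (a : 'rV['F_2]_(2 * k + 1)).

Lemma idx_cases (j : 'I_(2 * k)) :
  exists i : 'I_k, j = fst_idx i \/ j = snd_idx i.
Proof.
have ltk : (j./2 < k)%N.
  rewrite -ltn_double -[k.*2]mul2n; apply: leq_ltn_trans (ltn_ord j).
  by rewrite -[leqRHS]odd_double_half leq_addl.
exists (Ordinal ltk); have := odd_double_half j.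
by case: (odd j) => /= E; [right|left]; apply: val_inj; rewrite /= -[LHS]E.
Qed.

Lemma fst_idx_inj : injective (@fst_idx k).
Proof. by move=> i j /(congr1 val) /= /double_inj E; apply: val_inj. Qed.

Lemma snd_idx_inj : injective (@snd_idx k).
Proof. by move=> i j /(congr1 val) /= [/double_inj E]; apply: val_inj. Qed.

Lemma fst_idx_neq_snd i j : (fst_idx i == snd_idx j :> 'I_(2 * k)) = false.
Proof.
by apply/eqP => /(congr1 (odd \o val)) /=; rewrite !odd_double.
Qed.

Lemma bar_form_delta_fst v i :
  bar_form v (delta_mx 0 (fst_idx i)) = v 0 (snd_idx i).
Proof.
rewrite /bar_form (bigD1 i) //= big1 => [|j /negPf ji]; rewrite !mxE eqxx /=.
  rewrite [snd_idx _ == _]eq_sym fst_idx_neq_snd eqxx.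
  by rewrite mulr1 mulr0 subr0 addr0.
rewrite (inj_eq fst_idx_inj) ji [snd_idx _ == _]eq_sym fst_idx_neq_snd.
by rewrite !mulr0 subr0.
Qed.

Lemma bar_form_delta_snd v i :
  bar_form v (delta_mx 0 (snd_idx i)) = v 0 (fst_idx i).
Proof.
rewrite /bar_form (bigD1 i) //= big1 => [|j /negPf ji]; rewrite !mxE eqxx /=.
  by rewrite fst_idx_neq_snd eqxx mulr1 mulr0 sub0r oppr_F2 addr0.
by rewrite (inj_eq snd_idx_inj) ji fst_idx_neq_snd !mulr0 subr0.
Qed.

Lemma bar_form0r v : bar_form v 0 = 0.
Proof. by apply: big1 => i _; rewrite !mxE !mulr0 subr0. Qed.

Lemma bar_form_nondeg v : v != 0 -> exists w, bar_form v w = 1.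
Proof.
case/rV0Pn => j; have [i []->] := idx_cases j => /F2_neq0 vj.
  by exists (delta_mx 0 (snd_idx i)); rewrite bar_form_delta_snd.
by exists (delta_mx 0 (fst_idx i)); rewrite bar_form_delta_fst.
Qed.

(** Any two nonzero vectors are simultaneously non-orthogonal to a third: if
    x and y witness nondegeneracy for v and w separately and neither serves for
    both, then x + y does. *)
Lemma bar_form_common v w : v != 0 -> w != 0 ->
  exists x, bar_form v x = 1 /\ bar_form w x = 1.
Proof.
move=> /bar_form_nondeg[x vx] /bar_form_nondeg[y wy].
have [wx|wx] := F2_eq01 (bar_form w x); last by exists x.
have [vy|vy] := F2_eq01 (bar_form v y); last by exists y.
by exists (x + y); rewrite !bar_formDr vx wy wx vy addr0 add0r.
Qed.

Definition quad v : 'F_2 := \sum_(i < k) v 0 (fst_idx i) * v 0 (snd_idx i).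

Lemma F2_expr2 (x : 'F_2) : x ^+ 2 = x.
Proof. by case: (F2_eq01 x) => ->; rewrite expr2 ?mulr0 ?mulr1. Qed.

Lemma hformE a : hform a = quad (lsubmx a) + a 0 (last_idx k).
Proof.
rewrite /hform F2_expr2; congr (_ + _).
by apply: eq_bigr => i _; rewrite !mxE.
Qed.

(** The section of the projection F_2^(2k+1) -> F_2^(2k) whose image is the
    level set h = 1: the last coordinate enters h linearly, as x ^+ 2 = x, so
    the equation h = 1 determines it. *)
Definition root_lift v : 'rV['F_2]_(2 * k + 1) :=
  row_mx v (const_mx (1 + quad v)).

Lemma root_liftK : cancel root_lift lsubmx.
Proof. by move=> v; rewrite row_mxKl. Qed.

Lemma row_last_eq a b : lsubmx a = lsubmx b ->
  a 0 (last_idx k) = b 0 (last_idx k) -> a = b.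
Proof.
move=> El Er; rewrite -[a]hsubmxK -[b]hsubmxK El; congr row_mx.
by apply/rowP => i; rewrite !mxE (ord1 i) -/(last_idx k).
Qed.

Lemma root_lift_last v : root_lift v 0 (last_idx k) = 1 + quad v.
Proof. by rewrite row_mxEr mxE. Qed.

Lemma hform_eq1 a : hform a = 1 <-> a = root_lift (lsubmx a).
Proof.
rewrite hformE; split=> [E|->]; last first.
  by rewrite !root_liftK root_lift_last addrCA addrr_F2 addr0.
apply: row_last_eq; first by rewrite root_liftK.
by rewrite root_lift_last -E addrAC addrr_F2 add0r.
Qed.

Lemma lsubmx_e_last : lsubmx (e_last k) = 0.
Proof. by apply/rowP => i; rewrite !mxE /last_idx eq_lrshift andbF. Qed.

End SymplecticForm.

Lemma bichar0r (F : fieldType) (G : zmodType) (beta : alt_bichar F G) a :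
  beta a 0 = 1.
Proof. by have := bicharC beta a 0; rewrite bichar0l mulr1. Qed.

(** * The root system *)

Section RootSystem.
Variables (F : fieldType) (k : nat).
Hypothesis two : (2%:R : F) != 0.
Local Notation b := (beta F k).
Local Notation R := (Rminus F k).
Implicit Types (a c : 'rV['F_2]_(2 * k + 1)) (v w : 'rV['F_2]_(2 * k)).

Lemma betaE a c : b a c = sgn2 F (bar_form (lsubmx a) (lsubmx c)).
Proof. by rewrite -polarizationE. Qed.

Lemma nonsingular_beta_bar : nonsingular (beta_bar F k).
Proof.
apply/seteqP; split=> [v [_ rv]|_ ->] /=; last first.
  by split=> // w _; exact: bichar0l.
apply/eqP/negPn/negP => /bar_form_nondeg[w vw].
have /(sgn2_eq1 two)/eqP := rv w I.
by rewrite vw oner_eq0.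
Qed.

Lemma bichar_radE a : bichar_rad b a <-> lsubmx a = 0.
Proof.
split=> [[_ ra]|a0]; last first.
  split=> // c _; rewrite betaE a0.
  exact: (bichar0l (beta_bar F k)).
suff : bichar_rad (beta_bar F k) (lsubmx a) by rewrite nonsingular_beta_bar.
split=> // w _; have := ra (row_mx w 0) I.
by rewrite betaE row_mxKl.
Qed.

Lemma bichar_rad_beta : bichar_rad b = [set 0; e_last k].
Proof.
apply/seteqP; split=> [a /bichar_radE a0|a []-> /=]; last 2 first.
- by apply/bichar_radE; rewrite linear0.
- by apply/bichar_radE; rewrite lsubmx_e_last.
have [al|al] := F2_eq01 (a 0 (last_idx k)); [left | right]; apply: row_last_eq.
- by rewrite a0 linear0.
- by rewrite al mxE.
- by rewrite a0 lsubmx_e_last.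
- by rewrite al mxE !eqxx.
Qed.

(** The roots are exactly the lifts of the nonzero vectors of F_2^(2k); the
    reduction, the cardinality and the dimension of the Lie algebra all come
    from this parametrization. *)
Lemma RminusE a : R a <-> lsubmx a != 0 /\ a = root_lift (lsubmx a).
Proof.
rewrite /Rminus /= bichar_radE hform_eq1.
by split=> -[/eqP].
Qed.

Lemma Rminus_lift v : v != 0 -> R (root_lift v).
Proof. by move=> v0; apply/RminusE; rewrite root_liftK. Qed.

Lemma image_Rminus : lsubmx @` R = setT `\ 0.
Proof.
apply/seteqP; split=> [_ [a /RminusE[a0 _] <-]|v [_ /= /eqP v0]] /=.
  by split=> //; apply/eqP.
by exists (root_lift v); [exact: Rminus_lift | rewrite root_liftK].
Qed.

Lemma card_Rminus : #|R| = (2 ^ (2 * k) - 1)%N.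
Proof.
have -> : #|R| = #|[set root_lift v | v in predC1 (0 : 'rV['F_2]_(2 * k))]%SET|.
  apply: eq_card => a; apply/idP/imsetP => [/set_mem/RminusE[a0 ->]|[v v0 ->]].
    by exists (lsubmx a).
  by apply/mem_set/Rminus_lift.
rewrite card_imset; last exact: (can_inj (@root_liftK k)).
by rewrite cardC1 card_mx card_Fp // mul1n subn1.
Qed.

Lemma beta_neq1 a c : b a c <> 1 <-> bar_form (lsubmx a) (lsubmx c) = 1.
Proof. by rewrite betaE sgn2_neq1. Qed.

Lemma Rminus_add a c : R a -> R c -> b a c <> 1 -> R (a + c).
Proof.
move=> [_ ha] [_ hc] /[dup] bac /beta_neq1 fac; split.
  by move=> [_ /(_ c I)]; rewrite bicharDl bichar_alt mulr1.
have := polarizationE a c; rewrite fac /polarization ha hc.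
by rewrite -addrA -opprD addrr_F2 subr0.
Qed.

(** Besides the lifts, which cover every vector up to the radical, the
    generator of the radical has to be reached.  The sum of the lifts of v, w
    and v + w is (0, 1 + bar_form v w), so two distinct nonzero orthogonal
    vectors v and w suffice; they exist as soon as there are two hyperbolic
    planes. *)
Lemma Rminus_generates (k_ge2 : (2 <= k)%N) (K : set 'rV['F_2]_(2 * k + 1)) :
  is_subgroup K -> R `<=` K -> setT `<=` K.
Proof.
move=> [K0 KB] RK.
have KD x y : K x -> K y -> K (x + y).
  by move=> Kx Ky; rewrite -(oppr_rVF2 y); exact: KB.
pose i0 : 'I_k := Ordinal (ltnW k_ge2); pose i1 : 'I_k := Ordinal k_ge2.
pose v : 'rV['F_2]_(2 * k) := delta_mx 0 (fst_idx i0).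
pose w : 'rV['F_2]_(2 * k) := delta_mx 0 (fst_idx i1).
have i01 : (i0 == i1) = false by [].
have q0 (u : 'rV['F_2]_(2 * k)) : (forall i, u 0 (snd_idx i) = 0) -> quad u = 0.
  by move=> u0; apply: big1 => i _; rewrite u0 mulr0.
have sndv i : v 0 (snd_idx i) = 0.
  by rewrite mxE [_ == fst_idx _]eq_sym fst_idx_neq_snd andbF.
have sndw i : w 0 (snd_idx i) = 0.
  by rewrite mxE [_ == fst_idx _]eq_sym fst_idx_neq_snd andbF.
have Ke : K (e_last k).
  have -> : e_last k = root_lift v + root_lift w + root_lift (v + w).
    apply: row_last_eq.
      rewrite !linearD /= !root_liftK addrr_rVF2.
      exact: lsubmx_e_last.
    have sndvw i : (v + w) 0 (snd_idx i) = 0 by rewrite mxE sndv sndw addr0.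
    rewrite [RHS]mxE [X in X + _]mxE !root_lift_last !q0 //.
    by rewrite mxE !eqxx addr0 addrr_F2 add0r.
  have nz i (u : 'rV['F_2]_(2 * k)) : u 0 (fst_idx i) = 1 -> u != 0.
    by move=> ui; apply/rV0Pn; exists (fst_idx i); rewrite ui oner_eq0.
  apply: (KD); first apply: (KD); apply/RK/Rminus_lift.
  - by apply: (nz i0); rewrite !mxE !eqxx.
  - by apply: (nz i1); rewrite !mxE !eqxx.
  - by apply: (nz i0); rewrite !mxE !eqxx (inj_eq (@fst_idx_inj k)) i01 addr0.
move=> a _.
have [a0|a0] := eqVneq (lsubmx a) 0.
  have : bichar_rad b a by apply/bichar_radE.
  by rewrite bichar_rad_beta => -[]->.
(* Of a and a + e_last, the one where h = 1 is the lift. *)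
have Kl : K (root_lift (lsubmx a)) by exact/RK/Rminus_lift.
have [ha|/hform_eq1 -> //] := F2_eq01 (hform a).
suff -> : a = root_lift (lsubmx a) + e_last k by exact: KD.
apply: row_last_eq; first by rewrite linearD /= root_liftK lsubmx_e_last addr0.
rewrite [RHS]mxE root_lift_last [e_last k _ _]mxE !eqxx.
move: ha; rewrite hformE => /eqP; rewrite addr_eq0 oppr_F2 => /eqP ->.
by rewrite addrAC addrr_F2 add0r.
Qed.

Lemma bichar_rad_beta_bar_neqT (k_gt0 : (0 < k)%N) :
  bichar_rad (beta_bar F k) <> setT.
Proof.
pose v : 'rV['F_2]_(2 * k) := delta_mx 0 (fst_idx (Ordinal k_gt0)).
have v0 : v <> 0.
  by move=> /rowP/(_ (fst_idx (Ordinal k_gt0))); rewrite !mxE !eqxx.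
have := nonsingular_beta_bar; rewrite /nonsingular => -> E.
by apply: v0; have : [set: 'rV['F_2]_(2 * k)] v by []; rewrite -E.
Qed.

Lemma bichar_rad_beta_neqT (k_gt0 : (0 < k)%N) : bichar_rad b <> setT.
Proof.
move=> E; apply: (bichar_rad_beta_bar_neqT k_gt0).
apply/seteqP; split=> // v _; rewrite nonsingular_beta_bar /=.
have /bichar_radE : bichar_rad b (root_lift v) by rewrite E.
by rewrite root_liftK.
Qed.

Lemma skew_root_system_Rminus (k_ge2 : (2 <= k)%N) : skew_root_system b R.
Proof.
split.
- exact: bichar_rad_beta_neqT (ltnW k_ge2).
- by move=> a [ra _]; split.
- exact: Rminus_generates.
- apply/seteqP; split=> [a Ra|_ [a Ra <-]]; last by rewrite oppr_rVF2.
  by exists a; rewrite ?oppr_rVF2.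
- exact: Rminus_add.
Qed.

Lemma skew_root_system_beta_bar (k_gt0 : (0 < k)%N) :
  skew_root_system (beta_bar F k) (setT `\ 0).
Proof.
split.
- exact: bichar_rad_beta_bar_neqT.
- by move=> v [_ v0]; split=> // rv; apply: v0; rewrite -nonsingular_beta_bar.
- move=> K [K0 _] RK v _.
  by have [->//|/eqP v0] := eqVneq v 0; apply: RK.
- apply/seteqP; split=> [a Ra|_ [a Ra <-]]; last by rewrite oppr_rVF2.
  by exists a; rewrite ?oppr_rVF2.
- move=> v w _ _ bvw; split=> //= vw0; apply: bvw.
  rewrite -[LHS]mul1r -{1}(bichar_alt (beta_bar F k) v) -bicharDr vw0.
  exact: bichar0r.
Qed.

End RootSystem.

(** * Indecomposability *)

Section Indecomposable.
Variables (F : fieldType) (G : zmodType) (beta : alt_bichar F G).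

Lemma skew_root_system_in_nonempty (H R : set G) :
  skew_root_system_in beta H R -> exists a, R a.
Proof.
move=> [radH _ gen _ _]; apply/not_existsP => R0; apply: radH.
have H0 : H `<=` [set 0].
  apply: gen; last by move=> a /R0.
  by split=> // a b /= -> ->; rewrite subr0.
apply/seteqP; split=> [a []//|a Ha]; split=> // h _.
by rewrite (H0 a Ha) bichar0l.
Qed.

(** In a decomposition both parts contain a root, and a common neighbour of
    one root from each part can belong to neither part. *)
Lemma indecomposable_of_common_neighbour (R : set G) :
  (forall a b, R a -> R b ->
    exists c, [/\ R c, beta a c <> 1 & beta b c <> 1]) ->
  indecomposable beta R.
Proof.
move=> nbr [G1 [G2 [R1 [R2 [_ _ _ [RE orth] [s1 s2]]]]]].
have [a Ra] := skew_root_system_in_nonempty s1.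
have [b Rb] := skew_root_system_in_nonempty s2.
have [||c [Rc ac bc]] := nbr a b; rewrite ?RE; [by left | by right |].
move: Rc; rewrite RE => -[Rc|Rc]; last exact: ac (orth _ _ Ra Rc).
by apply: bc; have := bicharC beta b c; rewrite (orth _ _ Rc Rb) mulr1.
Qed.

End Indecomposable.

Lemma indecomposable_Rminus (F : fieldType) (k : nat) (two : (2%:R : F) != 0) :
  indecomposable (beta F k) (Rminus F k).
Proof.
apply: indecomposable_of_common_neighbour => a b.
move=> /(RminusE two)[a0 _] /(RminusE two)[b0 _].
have [x [ax bx]] := bar_form_common a0 b0.
have x0 : x != 0.
  apply/eqP => x0; move: ax; rewrite x0 bar_form0r => /eqP.
  by rewrite eq_sym oner_eq0.
exists (root_lift x); split; first exact: Rminus_lift.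
- by apply/beta_neq1 => //; rewrite root_liftK.
- by apply/beta_neq1 => //; rewrite root_liftK.
Qed.

(** * The reduction modulo the radical *)

Section ReducedQuotient.
Variables (F : fieldType) (k : nat).
Hypothesis two : (2%:R : F) != 0.
Local Notation b := (beta F k).

Definition quot_coord (x : quot_rad b) : 'rV['F_2]_(2 * k) :=
  lsubmx (repr (x : Quotient.quot (rad_pred b))).

(** The representative is immaterial: the radical is the kernel of lsubmx. *)
Lemma quot_coordE a : quot_coord (quot_proj b a) = lsubmx a.
Proof.
apply/eqP; rewrite -subr_eq0 -linearB; apply/eqP/(bichar_radE two)/set_mem.
have : repr (\pi_(Quotient.quot (rad_pred b)) a) - a \in rad_pred b.
  by rewrite Quotient.idealrBE reprK.
by [].
Qed.

Lemma quot_projB : {morph quot_proj b : x y / x - y}.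
Proof. by move=> x y; rewrite /quot_proj piE. Qed.

Lemma quot_coordB : {morph quot_coord : x y / x - y}.
Proof.
move=> x y; have [a ->] := quot_projP x; have [c ->] := quot_projP y.
by rewrite -quot_projB !quot_coordE linearB.
Qed.

Definition quot_coord_additive : {additive quot_rad b -> 'rV['F_2]_(2 * k)} :=
  HB.pack quot_coord (GRing.isZmodMorphism.Build _ _ quot_coord quot_coordB).

Lemma quot_coord_bij : bijective quot_coord.
Proof.
exists (fun v => quot_proj b (row_mx v 0)) => [x|v]; last first.
  by rewrite quot_coordE row_mxKl.
have [a ->] := quot_projP x; rewrite quot_coordE; apply/eqP.
rewrite /quot_proj -Quotient.idealrBE; apply/mem_set/(bichar_radE two).
by rewrite linearB /= row_mxKl subrr.
Qed.

Lemma quot_bichar_coord x y :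
  quot_bichar b x y = beta_bar F k (quot_coord x) (quot_coord y).
Proof.
have [a ->] := quot_projP x; have [c ->] := quot_projP y.
by rewrite !quot_coordE [LHS]quot_bicharE betaE.
Qed.

Lemma quot_coord_roots : quot_coord @` quot_roots b (Rminus F k) = setT `\ 0.
Proof.
rewrite -(image_Rminus k two) /quot_roots image_comp.
by apply: eq_imagel => a _; exact: quot_coordE.
Qed.

End ReducedQuotient.

(** * Symmetric cocycles on elementary abelian 2-groups *)

Lemma closed_sqrt (F : closedFieldType) (c : F) : exists s, s * s = c.
Proof.
have /closed_rootP[s] : size ('X^2 - c%:P : {poly F}) != 1.
  by rewrite size_XnsubC.
by rewrite rootE !hornerE subr_eq0 => /eqP; exists s.
Qed.

Section SymmetricCocycle.
Variables (F : closedFieldType) (G : finZmodType) (sigma : cocycle2 F G).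
Hypothesis two_torsion : forall a : G, a + a = 0.
Hypothesis sigmaC : forall a b, sigma a b = sigma b a.
Local Notation u := (tw_basis sigma).

Lemma tw_basisM (a b : G) : u a * u b = sigma a b *: u (a + b).
Proof. exact: tw_mul_basis. Qed.

(** By symmetry of sigma the u_g commute, and each u_g squares to a scalar
    r ^+ 2.  Given a common eigenvector x of the previous elements, either
    u_g x = - r x already, or (u_g + r) x is a nonzero r-eigenvector of u_g,
    on which the previous elements still act by the same scalars. *)
Lemma basis_common_eigenvector (s : seq G) : exists2 x : tw_alg sigma, x != 0 &
  forall g, g \in s -> exists l : F, u g * x = l *: x.
Proof.
elim: s => [|g s [x x0 IH]]; first by exists 1; rewrite ?oner_eq0.
have [r rr] := closed_sqrt (sigma g g * sigma 0 0).
have ugg : u g * u g = (r * r)%:A.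
  rewrite tw_basisM two_torsion rr -scalerA; congr (_ *: _).
  by rewrite /GRing.one /= /tw_one scalerA mulfV ?cocycle_neq0 ?scale1r.
pose y := u g * x + r *: x.
have uy : u g * y = r *: y.
  rewrite mulrDr mulrA ugg -scalerAl mul1r -scalerAr scalerDr scalerA.
  by rewrite addrC.
have [y0|y0] := eqVneq y 0.
  exists x => // h; rewrite inE => /predU1P[->|/IH//].
  by exists (- r); rewrite scaleNr; apply/eqP; rewrite -addr_eq0; apply/eqP.
exists y => // h; rewrite inE => /predU1P[->|/IH[l hx]]; first by exists r.
exists l; rewrite mulrDr -scalerAr hx mulrA.
have -> : u h * u g = u g * u h by rewrite !tw_basisM sigmaC addrC.
by rewrite -mulrA hx -scalerAr scalerDr !scalerA mulrC.
Qed.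

(** The eigenvalues of the u_g on a common eigenvector trivialize sigma. *)
Lemma symmetric_cocycle_coboundary : exists l : G -> F,
  (forall a, l a != 0) /\ forall a b, l a * l b = sigma a b * l (a + b).
Proof.
have [x x0 ev] := basis_common_eigenvector (enum G).
have {}ev g : exists l : F, u g * x = l *: x by apply: ev; rewrite mem_enum.
pose l g := xget 0 [set c : F | u g * x = c *: x].
have lE g : u g * x = l g *: x.
  by rewrite /l; case: xgetP => [c _ //|nex]; have [c /nex] := ev g.
have scI (c d : F) : c *: x = d *: x -> c = d.
  move=> /eqP; rewrite -subr_eq0 -scalerBl scaler_eq0 (negPf x0) orbF.
  by rewrite subr_eq0 => /eqP.
have lM a b : l a * l b = sigma a b * l (a + b).
  apply: scI; rewrite mulrC -scalerA -lE scalerAr -lE mulrA tw_basisM.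
  by rewrite -scalerAl lE scalerA.
have l0 : l 0 != 0.
  rewrite (_ : l 0 = sigma 0 0) ?cocycle_neq0 //; apply: scI; rewrite -lE.
  have -> : u 0 = sigma 0 0 *: 1.
    by rewrite /GRing.one /= /tw_one scalerA mulfV ?cocycle_neq0 ?scale1r.
  by rewrite -scalerAl mul1r.
exists l; split=> // a; apply: contraTneq l0 => la0; apply/negPn/eqP.
apply: (mulfI (cocycle_neq0 sigma a a)).
by rewrite mulr0 -(two_torsion a) -lM la0 mulr0.
Qed.

End SymmetricCocycle.

(** * Pauli matrices *)

Section PauliMatrices.
Variables (F : fieldType) (k : nat).
Implicit Types v w : 'rV['F_2]_(2 * k).

Lemma card_sites : #|{: 'rV['F_2]_k}| = (2 ^ k)%N.
Proof. by rewrite card_mx card_Fp // mul1n. Qed.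

Definition site (i : 'I_(2 ^ k)) : 'rV['F_2]_k :=
  enum_val (cast_ord (esym card_sites) i).

Lemma site_bij : bijective site.
Proof.
exists (fun x => cast_ord card_sites (enum_rank x)) => x; rewrite /site.
  by rewrite enum_valK cast_ordKV.
by rewrite cast_ordK enum_rankK.
Qed.

Lemma site_inj : injective site. Proof. exact: bij_inj site_bij. Qed.

(** The split of F_2^(2k) into the two Lagrangian subspaces spanned by the
    first and by the second vectors of the hyperbolic pairs. *)
Definition xpart v : 'rV['F_2]_k := \row_i v 0 (fst_idx i).
Definition zpart v : 'rV['F_2]_k := \row_i v 0 (snd_idx i).
Definition dot (x y : 'rV['F_2]_k) : 'F_2 := \sum_i x 0 i * y 0 i.

Lemma xpartD v w : xpart (v + w) = xpart v + xpart w.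
Proof. by apply/rowP => i; rewrite !mxE. Qed.

Lemma zpartD v w : zpart (v + w) = zpart v + zpart w.
Proof. by apply/rowP => i; rewrite !mxE. Qed.

Lemma dotDl x y z : dot (x + y) z = dot x z + dot y z.
Proof. by rewrite -big_split; apply: eq_bigr => i _; rewrite mxE mulrDl. Qed.

Lemma dotDr x y z : dot x (y + z) = dot x y + dot x z.
Proof. by rewrite -big_split; apply: eq_bigr => i _; rewrite mxE mulrDr. Qed.

Lemma dotC x y : dot x y = dot y x.
Proof. by apply: eq_bigr => i _; rewrite mulrC. Qed.

Lemma half_formE (a b : 'rV['F_2]_(2 * k + 1)) :
  half_form a b = dot (xpart (lsubmx a)) (zpart (lsubmx b)).
Proof. by apply: eq_bigr => i _; rewrite !mxE. Qed.

Lemma bar_formE v w :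
  bar_form v w = dot (xpart v) (zpart w) + dot (xpart w) (zpart v).
Proof.
rewrite -big_split; apply: eq_bigr => i _; rewrite !mxE oppr_F2.
by rewrite addrC [X in _ + X]mulrC.
Qed.

(** On row vectors, in the basis indexed by F_2^k: the operator which
    translates the basis vector at s to s + x and multiplies it by the sign
    (-1)^(z . s), where x and z are the two parts of v. *)
Definition pauli v : 'M[F]_(2 ^ k) :=
  \matrix_(i, j)
    (sgn2 F (dot (zpart v) (site i)) * (site j == site i + xpart v)%:R).

Lemma pauliM v w :
  pauli v *m pauli w = sgn2 F (dot (xpart v) (zpart w)) *: pauli (v + w).
Proof.
have [g siteK gK] := site_bij.
apply/matrixP => i j; rewrite !mxE (bigD1 (g (site i + xpart v))) //=.
rewrite big1 => [|l /eqP ne]; last first.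
  rewrite !mxE; case: eqP => [E|]; last by rewrite mulr0 mul0r.
  by case: ne; rewrite -E siteK.
rewrite !mxE !gK eqxx addr0 mulr1 xpartD addrA zpartD dotDl dotDr !sgn2D.
by rewrite (dotC (zpart w) (xpart v)); ring.
Qed.

Lemma pauli0 : pauli 0 = 1%:M.
Proof.
apply/matrixP => i j; rewrite !mxE.
have -> : zpart 0 = 0 by apply/rowP => l; rewrite !mxE.
have -> : xpart 0 = 0 by apply/rowP => l; rewrite !mxE.
rewrite addr0 (inj_eq site_inj) eq_sym /dot big1 ?mul1r //.
by move=> l _; rewrite mxE mul0r.
Qed.

Lemma pauli_comm v w :
  pauli v *m pauli w = sgn2 F (bar_form v w) *: (pauli w *m pauli v).
Proof.
by rewrite !pauliM scalerA -sgn2D bar_formE -addrA addrr_F2 addr0 addrC.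
Qed.

Lemma pauli_sq v : exists2 s : F, s != 0 & pauli v *m pauli v = s%:M.
Proof.
exists (sgn2 F (dot (xpart v) (zpart v))); first exact: sgn2_neq0.
by rewrite pauliM addrr_rVF2 pauli0 scalemx1.
Qed.

(** The matrix of v changes sign under conjugation by that of a vector w not
    orthogonal to v, and conjugation preserves the trace. *)
Lemma trace_pauli (two : (2%:R : F) != 0) v : v != 0 -> \tr (pauli v) = 0.
Proof.
case/bar_form_nondeg => w vw; have [s s0 ww] := pauli_sq w.
have E : \tr (pauli v *m pauli w *m pauli w) =
         - \tr (pauli v *m pauli w *m pauli w).
  rewrite {1}pauli_comm vw sgn2_1 -scalemxAl mxtraceZ mulN1r; congr (- _).
  by rewrite mxtrace_mulC mulmxA mxtrace_mulC mulmxA.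
move/eqP: E; rewrite -mulmxA ww mul_mx_scalar mxtraceZ -addr_eq0 -mulr2n.
by rewrite -mulr_natl !mulf_eq0 (negPf two) (negPf s0) => /eqP.
Qed.

Hypothesis charF0 : [pchar F] =i pred0.

(** The trace form pairs distinct Pauli matrices to 0 and each of them with
    itself to plus or minus 2^k, which is nonzero in characteristic 0. *)
Lemma pauli_free (c : 'rV['F_2]_(2 * k) -> F) :
  \sum_v c v *: pauli v = 0 -> forall v, c v = 0.
Proof.
have two : (2%:R : F) != 0 by rewrite ((pcharf0P F).1 charF0).
move=> E w; have [s s0 ww] := pauli_sq w.
have : \tr ((\sum_v c v *: pauli v) *m pauli w) = 0.
  by rewrite E mul0mx mxtrace0.
rewrite mulmx_suml raddf_sum /= (bigD1 w) //= big1 => [|v vw].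
  rewrite -scalemxAl ww mxtraceZ mxtrace_scalar -mulr_natl.
  move/eqP; rewrite addr0 !mulf_eq0 (negPf s0).
  by rewrite ((pcharf0P F).1 charF0) expn_eq0 /= orbF => /eqP.
rewrite -scalemxAl pauliM !mxtraceZ trace_pauli ?mulr0 //.
by rewrite addr_eq0 oppr_rVF2.
Qed.

(** There are 4^k independent Pauli matrices, the dimension of the space. *)
Lemma pauli_span (M : 'M[F]_(2 ^ k)) : exists c, M = \sum_v c v *: pauli v.
Proof.
pose X := [tuple pauli (enum_val i) | i < #|{: 'rV['F_2]_(2 * k)}|].
have nthX v : X`_(enum_rank v) = pauli v.
  by rewrite -tnth_nth tnth_mktuple enum_rankK.
have freeX : free X.
  apply/freeP => c E i; rewrite -[i]enum_valK.
  pose c' v := c (enum_rank v); suff : c' (enum_val i) = 0 by [].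
  apply: pauli_free; rewrite -[RHS]E [RHS](reindex enum_rank) /=; last first.
    by apply: onW_bij; exact: enum_rank_bij.
  by apply: eq_bigr => v _; rewrite -nthX.
have /span_basis spanX : basis_of fullv X.
  rewrite basisEfree freeX subvf dimvf dim_matrix size_tuple card_mx card_Fp //.
  by rewrite mul1n mul2n -addnn expnD /=; exact: leqnn.
have : M \in <<X>>%VS by rewrite spanX memvf.
move=> /coord_span ->; exists (fun v => coord X (enum_rank v) M).
rewrite [LHS](reindex enum_rank) /=; last first.
  by apply: onW_bij; exact: enum_rank_bij.
by apply: eq_bigr => v _; rewrite -nthX.
Qed.

End PauliMatrices.

(** * Root spaces of twisted group algebras *)

Section RootSpace.
Variables (F : fieldType) (G : finZmodType) (xi : cocycle2 F G).
Implicit Types (x y : tw_alg xi) (R : set G).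

Lemma root_spaceE R x : root_space xi R x <-> forall a, ~ R a -> x a = 0.
Proof.
split=> [[c ->] a Ra|x0].
  rewrite sum_ffunE big1 // => d /set_mem Rd; rewrite !ffunE.
  by case: eqP => [ad|_]; [case: Ra; rewrite ad | rewrite scaler0].
exists x; rewrite [LHS]tw_expand [RHS]big_mkcond; apply: eq_bigr => a _.
by case: ifPn => // /negP Ra; rewrite x0 ?scale0r // => /mem_set.
Qed.

Lemma tw_mulE x y c :
  (x * y) c = \sum_a \sum_b x a * y b * xi a b * (c == a + b)%:R.
Proof.
rewrite sum_ffunE; apply: eq_bigr => a _; rewrite sum_ffunE.
by apply: eq_bigr => b _; rewrite !ffunE.
Qed.

(** The bracket of u_a and u_b is a multiple of u_(a + b) that vanishes when
    beta a b = 1, and otherwise a + b is a root. *)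
Lemma root_space_lie (beta : alt_bichar F G) R : cocycle_for xi beta ->
  (forall a b, R a -> R b -> beta a b <> 1 -> R (a + b)) ->
  lie_subalgebra (@ring_commutator (tw_alg xi)) (root_space xi R).
Proof.
move=> xib Radd; split.
- by apply/root_spaceE => a _; rewrite ffunE.
- move=> c x y /root_spaceE x0 /root_spaceE y0; apply/root_spaceE => a Ra.
  by rewrite !ffunE x0 // y0 // scaler0 addr0.
move=> x y /root_spaceE x0 /root_spaceE y0; apply/root_spaceE => c Rc.
rewrite /ring_commutator !ffunE !tw_mulE [X in _ - X]exchange_big /=.
rewrite -sumrB big1 // => a _; rewrite -sumrB big1 // => b _.
rewrite (addrC b); case: eqP => [cE|_]; last by rewrite !mulr0 subrr.
have [Ra|/x0 ->] := pselect (R a); last by rewrite !(mul0r, mulr0) subrr.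
have [Rb|/y0 ->] := pselect (R b); last by rewrite !(mul0r, mulr0) subrr.
suff -> : xi a b = xi b a by rewrite (mulrC (x a)) subrr.
have [bab|/Radd Rab] := pselect (beta a b = 1); last first.
  by case: Rc; rewrite cE; exact: Rab.
apply: (mulIf (invr_neq0 (cocycle_neq0 xi b a))).
by rewrite xib bab mulfV ?cocycle_neq0.
Qed.

Section Representation.
Variables (n : nat) (rho : G -> 'M[F]_n).
Hypothesis rhoM : forall a b, rho a *m rho b = xi a b *: rho (a + b).

Definition tw_rep x : 'M[F]_n := \sum_a x a *: rho a.

Lemma tw_repP c x y : tw_rep (c *: x + y) = c *: tw_rep x + tw_rep y.
Proof.
rewrite /tw_rep scaler_sumr -big_split; apply: eq_bigr => a _ /=.
by rewrite !ffunE scalerDl scalerA.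
Qed.

Lemma tw_repM x y : tw_rep (x * y) = tw_rep x *m tw_rep y.
Proof.
rewrite /tw_rep mulmx_suml.
transitivity (\sum_a \sum_b (x a * y b * xi a b) *: rho (a + b)).
  under eq_bigr => c _ do rewrite tw_mulE scaler_suml.
  rewrite exchange_big; apply: eq_bigr => a _ /=.
  under eq_bigr => c _ do rewrite scaler_suml.
  rewrite exchange_big; apply: eq_bigr => b _ /=.
  rewrite (bigD1 (a + b)) //= eqxx mulr1 big1 ?addr0 // => c /negPf ->.
  by rewrite mulr0 scale0r.
apply: eq_bigr => a _; rewrite mulmx_sumr; apply: eq_bigr => b _.
by rewrite -scalemxAl -scalemxAr rhoM !scalerA.
Qed.

End Representation.
End RootSpace.

(** * The Lie algebra of the root system *)

Lemma sl_lie n (F : fieldType) :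
  lie_subalgebra (@ring_commutator 'M[F]_n) (sl n F).
Proof.
rewrite /sl; split=> [|c M N /= M0 N0|M N _ _] /=; first exact: mxtrace0.
  by rewrite mxtraceD mxtraceZ M0 N0 mulr0 addr0.
by rewrite /ring_commutator raddfB /= [X in _ - X]mxtrace_mulC subrr.
Qed.

Section LieAlgebra.
Variables (F : closedFieldType) (k : nat).
Hypothesis charF0 : [pchar F] =i pred0.
Local Notation b := (beta F k).
Local Notation R := (Rminus F k).
Variable xi : cocycle2 F 'rV['F_2]_(2 * k + 1).
Hypothesis xib : cocycle_for xi b.

Let two : (2%:R : F) != 0.
Proof. by rewrite ((pcharf0P F).1 charF0). Qed.

Lemma sign_twistP a c d :
  xi a c * half_cocycle F k a c * (xi (a + c) d * half_cocycle F k (a + c) d) =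
  xi c d * half_cocycle F k c d * (xi a (c + d) * half_cocycle F k a (c + d)).
Proof. by rewrite mulrACA cocycleP (cocycleP (half_cocycle F k)) mulrACA. Qed.

(** The quotient of xi by the half cocycle, which takes the values 1 and -1
    and is therefore its own inverse.  It is symmetric because both cocycles
    have the commutator beta. *)
Definition sign_twist : cocycle2 F 'rV['F_2]_(2 * k + 1) :=
  Cocycle2
    (fun a c => mulf_neq0 (cocycle_neq0 xi a c)
                          (cocycle_neq0 (half_cocycle F k) a c))
    sign_twistP.

Lemma sign_twistC a c : sign_twist a c = sign_twist c a.
Proof.
rewrite /=; set s := sgn2 F (half_form a c); set t := sgn2 F (half_form c a).
have : xi a c * (xi c a)^-1 = s * t^-1.
  by rewrite xib -cocycle_for_beta.
move/eqP; rewrite eqr_div ?sgn2_neq0 ?cocycle_neq0 // => /eqP E.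
have tt : t * t = 1 by exact: sgn2_sq.
have ss : s * s = 1 by exact: sgn2_sq.
by rewrite -[LHS]mulr1 -tt mulrACA E mulrACA ss mul1r.
Qed.

(** As the sign twist is a coboundary, rescaled Pauli matrices multiply
    according to xi; they carry an action of the whole twisted group algebra
    in which the radical acts by scalars. *)
Lemma pauli_rep : exists l : 'rV['F_2]_(2 * k + 1) -> F, (forall a, l a != 0) /\
  let rho a := l a *: pauli F (lsubmx a) in
  forall a c, rho a *m rho c = xi a c *: rho (a + c).
Proof.
have [l [l0 lM]] := symmetric_cocycle_coboundary (@addrr_rVF2 _) sign_twistC.
exists l; split=> // rho a c; rewrite /rho -scalemxAl -scalemxAr pauliM.
rewrite -half_formE !scalerA lM linearD /=; congr (_ *: _).
by rewrite -mulrA mulrAC -!mulrA sgn2_sq mulr1.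
Qed.

Lemma sum_Rminus (V : zmodType) (f : 'rV['F_2]_(2 * k + 1) -> V) :
  (forall a, ~ R a -> f a = 0) ->
  \sum_a f a = \sum_(v | v != 0) f (root_lift v).
Proof.
move=> f0; rewrite (bigID (mem R)) /= [X in _ + X]big1 ?addr0; last first.
  by move=> a /negP Ra; apply: f0 => /mem_set.
rewrite (reindex_onto (@root_lift k) lsubmx) /=; last first.
  by move=> a /set_mem/(RminusE two)[_ <-].
apply: eq_bigl => v; rewrite root_liftK eqxx andbT.
apply/idP/idP => [/set_mem/(RminusE two)[]|v0]; first by rewrite root_liftK.
by apply/mem_set/Rminus_lift.
Qed.

(** The traceless matrices are the combinations of the Pauli matrices at
    nonzero v, and above each such v lies exactly one root; so the action of
    the twisted group algebra by rescaled Pauli matrices, which preserves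
    commutators, maps the root space bijectively onto sl. *)
Lemma Rminus_lie_sl :
  lie_isomorphic (@ring_commutator (tw_alg xi)) (@ring_commutator 'M[F]_(2 ^ k))
    (root_space xi R) (sl (2 ^ k) F).
Proof.
split; [exact: root_space_lie xib (Rminus_add two) | exact: sl_lie |].
have [l [l0 rhoM]] := pauli_rep; set rho := fun a => _ in rhoM.
have repE x : root_space xi R x ->
  tw_rep rho x =
    \sum_(v | v != 0) (x (root_lift v) * l (root_lift v)) *: pauli F v.
  move=> /root_spaceE x0; rewrite /tw_rep sum_Rminus => [|a /x0 ->]; last first.
    by rewrite scale0r.
  by apply: eq_bigr => v _; rewrite /rho scalerA root_liftK.
exists (tw_rep rho); split; last 2 first.
- by move=> c x y _ _; exact: tw_repP.
- move=> x y _ _; rewrite /ring_commutator -![tw_rep rho _ * _]tw_repM //.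
  by rewrite addrC -scaleN1r tw_repP scaleN1r addrC.
split.
- move=> x /repE ->; rewrite /sl /= raddf_sum big1 //= => v v0.
  by rewrite mxtraceZ trace_pauli ?mulr0.
- move=> x y /set_mem Rx /set_mem Ry; rewrite !repE // => E.
  apply/ffunP => a.
  have [/(RminusE two)[a0 aE]|Ra] := pselect (R a); last first.
    by rewrite ((root_spaceE _ _).1 Rx) // ((root_spaceE _ _).1 Ry).
  apply: (mulIf (l0 a)); apply/eqP; rewrite -subr_eq0.
  pose c v := if v != 0 then x (root_lift v) * l (root_lift v)
    - y (root_lift v) * l (root_lift v) else 0.
  have : c (lsubmx a) = 0.
    apply: (pauli_free charF0).
    move/eqP: E; rewrite -subr_eq0 -sumrB big_mkcond => /eqP E.
    rewrite -[RHS]E; apply: eq_bigr => v _; rewrite /c.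
    by case: eqP => _ /=; rewrite ?scale0r ?scalerBl.
  by rewrite /c a0 -aE => ->.
- move=> M /= M0; have [c cE] := pauli_span charF0 M.
  have c0 : c 0 = 0.
    move: M0; rewrite /sl /= cE raddf_sum /= (bigD1 0) //= big1 => [|v v0].
      rewrite mxtraceZ pauli0 mxtrace_scalar addr0 => /eqP.
      by rewrite mulf_eq0 ((pcharf0P F).1 charF0) expn_eq0 orbF => /eqP.
    by rewrite mxtraceZ trace_pauli ?mulr0.
  pose x : tw_alg xi := [ffun a => if a \in R then c (lsubmx a) / l a else 0].
  have Rx : root_space xi R x.
    by apply/root_spaceE => a Ra; rewrite ffunE memNset.
  exists x; rewrite // repE // cE [RHS](bigD1 0) //= c0 scale0r add0r.
  apply: eq_bigr => v v0; rewrite ffunE mem_set; last exact: Rminus_lift.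
  by rewrite root_liftK divfK.
Qed.

End LieAlgebra.

Theorem proposition5p7 (F : closedFieldType) (charF0 : [pchar F] =i pred0)
    (k : nat) (k_ge2 : (2 <= k)%N) :
  let b := beta F k in
  let R := Rminus F k in
  [/\ bichar_rad b = [set 0; e_last k],
      skew_root_system b R &
      [/\ exists phi : {additive quot_rad b -> 'rV['F_2]_(2 * k)},
            [/\ bijective phi,
                forall a : 'rV['F_2]_(2 * k + 1), phi (quot_proj b a) = lsubmx a,
                forall x y, quot_bichar b x y = beta_bar F k (phi x) (phi y) &
                phi @` quot_roots b R = setT `\ 0],
          nonsingular (beta_bar F k)
            /\ skew_root_system (beta_bar F k) (setT `\ 0),
          ~ reduced b R /\ indecomposable b R,
          #|R| = (2 ^ (2 * k) - 1)%N &
          forall xi : cocycle2 F 'rV['F_2]_(2 * k + 1), cocycle_for xi b ->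
            lie_isomorphic (@ring_commutator (tw_alg xi)) (@ring_commutator 'M[F]_(2 ^ k))
              (root_space xi R) (sl (2 ^ k) F)]].
Proof.
move=> b R.
have two : (2%:R : F) != 0 by rewrite ((pcharf0P F).1 charF0).
have rad_b : bichar_rad b = [set 0; e_last k] by exact: bichar_rad_beta.
split=> //; first exact: skew_root_system_Rminus.
split.
- exists (quot_coord_additive k two); split.
  + exact: (quot_coord_bij k two).
  + exact: (quot_coordE two).
  + exact: (quot_bichar_coord two).
  + exact: (quot_coord_roots _ two).
- split; first exact: (nonsingular_beta_bar _ two).
  exact: skew_root_system_beta_bar (ltnW k_ge2).
- split; last exact: indecomposable_Rminus.
  rewrite /reduced /nonsingular rad_b => /seteqP[/(_ (e_last k)) e0 _].
  by move: (e0 (or_intror erefl)) => /rowP/(_ (last_idx k)); rewrite !mxE !eqxx.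
- exact: (card_Rminus _ two).
- by move=> xi xib; exact: Rminus_lie_sl.
Qed.
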